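(* The following hold. (1) $|S_n(12\text{-}3,1\text{-}23,31\text{-}2,3\text{-}12)|=1+\binom{n}{2}$ for every $n\ge1$. (2) $|S_n(1\text{-}23,21\text{-}3,1\text{-}32,12\text{-}3)|=\binom{n}{\lceil n/2\rceil}$ for every $n\ge1$. (3) $|S_n(1\text{-}23,23\text{-}1,3\text{-}12,12\text{-}3)|=2^{n-2}+1$ for every $n\ge2$. (4) $|S_n(12\text{-}3,2\text{-}13,32\text{-}1,21\text{-}3)|=3$ for every $n\ge3$.
   Context: $S_n$ is the set of permutations $\pi=\pi_1\pi_2\cdots\pi_n$ of $\{1,\dots,n\}$. For $abc$ a permutation of $123$, the generalized pattern $a\text{-}bc$ is contained in $\pi$ if there are indices $i<j$ with $j+1\le n$ such that $\pi_i\pi_j\pi_{j+1}$ is order-isomorphic to $abc$; the generalized pattern $ab\text{-}c$ is contained in $\pi$ if there are indices $i,k$ with $i+1<k\le n$ such that $\pi_i\pi_{i+1}\pi_k$ is order-isomorphic to $abc$. (Letters not separated by a dash must occur in adjacent positions; letters separated by a dash need not be adjacent.) $\pi$ avoids a pattern if it does not contain it. $S_n(p_1,\dots,p_m)$ is the set of $\pi\in S_n$ avoiding all of $p_1,\dots,p_m$. *)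

(* Defs.v *)
From mathcomp Require Import all_boot all_fingroup.

Set Implicit Arguments.
Unset Strict Implicit.
Unset Printing Implicit Defensive.

(* A permutation pi_1 ... pi_n of {1, ..., n} is encoded as pi : 'S_n, acting
   on 'I_n = {0, ..., n-1}: both positions and values are shifted down by 1,
   which changes neither adjacency of positions nor relative order of values. *)

Definition order_isomorphic (s t : seq nat) : bool :=
  (size s == size t) &&
  [forall i : 'I_(size s), forall j : 'I_(size s),
     (nth 0 s i < nth 0 s j) == (nth 0 t i < nth 0 t j)].

(* DashL a b c is the generalized pattern a-bc, and DashR a b c is ab-c;
   abc is meant to be a permutation of 123. *)
Inductive gpattern : Type :=
  | DashL of nat & nat & nat
  | DashR of nat & nat & nat.

Definition contains (n : nat) (pi : 'S_n) (p : gpattern) : bool :=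
  match p with
  | DashL a b c =>
      [exists i : 'I_n, exists j : 'I_n, exists j' : 'I_n,
         [&& i < j, j' == j.+1 :> nat &
             order_isomorphic [:: val (pi i); val (pi j); val (pi j')]
                              [:: a; b; c]]]
  | DashR a b c =>
      [exists i : 'I_n, exists i' : 'I_n, exists k : 'I_n,
         [&& i' == i.+1 :> nat, i' < k &
             order_isomorphic [:: val (pi i); val (pi i'); val (pi k)]
                              [:: a; b; c]]]
  end.

Definition avoids (n : nat) (pi : 'S_n) (p : gpattern) : bool :=
  ~~ contains pi p.

Definition avoiders (n : nat) (ps : seq gpattern) : {set 'S_n} :=
  [set pi : 'S_n | all (avoids pi) ps].

(* Main.v *)
Require Import Defs.
From mathcomp Require Import all_boot all_fingroup.
From mathcomp Require Import zify.

Set Implicit Arguments.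
Unset Strict Implicit.
Unset Printing Implicit Defensive.

(* Permutations are read as words. A word x w avoids a dashed pattern iff w does
   and no occurrence starts at the letter x, so the avoiding words are found by
   prepending letters.
   (1) The patterns force every letter before an ascent bc to lie between b and
   c, and the letters of the descents before it to be consecutive values. Hence
   there is at most one ascent, and a word with one ascent is B A C, where A B C
   is the decreasing word and A, B are nonempty: a choice of two cut points.
   (2) The maximum of every suffix is one of its first two letters. Fixing the
   set B of the letters exceeding some earlier letter, in which no two adjacent
   letters may lie, gives a Pascal recursion with value
   C(m, ceil((|B| + m) / 2)), where m is the number of the other letters.
   (3) Every other letter lies between the two letters of an ascent, so an
   ascent is the pair (min, max) and a word with an ascent is u min max v with u
   and v decreasing: a choice of the set of letters of u.
   (4) The words are the zigzag min max min' max' ..., the zigzag max min ...,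
   and the zigzag on all but the two largest letters preceded by these two in
   increasing order. *)

(** * Avoidance on words *)

Lemma order_isomorphic3 (x y z a b c : nat) :
  order_isomorphic [:: x; y; z] [:: a; b; c] =
  [&& (x < y) == (a < b), (x < z) == (a < c), (y < x) == (b < a),
      (y < z) == (b < c), (z < x) == (c < a) & (z < y) == (c < b)].
Proof.
rewrite /order_isomorphic /=; apply/forallP/idP => [H|].
  pose o k (lk : k < 3) := Ordinal lk.
  have h i j (li : i < 3) (lj : j < 3) := forallP (H (o i li)) (o j lj).
  have := (h 0 1 isT isT, h 0 2 isT isT, h 1 0 isT isT,
           (h 1 2 isT isT, h 2 0 isT isT, h 2 1 isT isT)).
  by rewrite /= => -[[[-> ->] ->] [[-> ->] ->]].
case/and5P=> h1 h2 h3 h4 /andP[h5 h6] [[|[|[|//]]] i3]; apply/forallP;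
  by case=> -[|[|[|//]]] j3 //=; rewrite !ltnn.
Qed.

Lemma order_isomorphic_123 x y z :
  order_isomorphic [:: x; y; z] [:: 1; 2; 3] = (x < y < z).
Proof. by rewrite order_isomorphic3; lia. Qed.

Lemma order_isomorphic_132 x y z :
  order_isomorphic [:: x; y; z] [:: 1; 3; 2] = (x < z < y).
Proof. by rewrite order_isomorphic3; lia. Qed.

Lemma order_isomorphic_213 x y z :
  order_isomorphic [:: x; y; z] [:: 2; 1; 3] = (y < x < z).
Proof. by rewrite order_isomorphic3; lia. Qed.

Lemma order_isomorphic_231 x y z :
  order_isomorphic [:: x; y; z] [:: 2; 3; 1] = (z < x < y).
Proof. by rewrite order_isomorphic3; lia. Qed.

Lemma order_isomorphic_312 x y z :
  order_isomorphic [:: x; y; z] [:: 3; 1; 2] = (y < z < x).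
Proof. by rewrite order_isomorphic3; lia. Qed.

Lemma order_isomorphic_321 x y z :
  order_isomorphic [:: x; y; z] [:: 3; 2; 1] = (z < y < x).
Proof. by rewrite order_isomorphic3; lia. Qed.

Definition order_isomorphicE :=
  (order_isomorphic_123, order_isomorphic_132, order_isomorphic_213,
   order_isomorphic_231, order_isomorphic_312, order_isomorphic_321).

Definition matches (p : gpattern) (x y z : nat) : bool :=
  match p with
  | DashL a b c | DashR a b c => order_isomorphic [:: x; y; z] [:: a; b; c]
  end.

(** Concerns the occurrences whose first letter is a letter [x] standing in front of [w]. [sorted]
    inspects exactly the adjacent pairs of [w], where the undashed pair of a-bc must lie; for ab-c
    the second letter can only be the head of [w]. *)
Definition first_avoids (p : gpattern) (x : nat) (w : seq nat) : bool :=
  match p with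
  | DashL _ _ _ => sorted (fun y z => ~~ matches p x y z) w
  | DashR _ _ _ => if w is y :: w' then all (fun z => ~~ matches p x y z) w'
                   else true
  end.

Fixpoint all_suffixes (Q : nat -> seq nat -> bool) (w : seq nat) : bool :=
  if w is x :: w' then Q x w' && all_suffixes Q w' else true.

Lemma all_suffixesP (Q : nat -> seq nat -> bool) w :
  reflect (forall i, i < size w -> Q (nth 0 w i) (drop i.+1 w))
          (all_suffixes Q w).
Proof.
elim: w => [|x w IHw] /=; first by left.
apply: (iffP andP) => [[Qx /IHw IH] [_|i]|H].
- by rewrite drop0.
- exact: IH.
split; first by have := H 0 isT; rewrite /= drop0.
by apply/IHw => i; apply: (H i.+1).
Qed.

Lemma all_suffixes_all ps w :
  all_suffixes (fun x w' => all (fun p => first_avoids p x w') ps) w =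
  all (fun p => all_suffixes (first_avoids p) w) ps.
Proof.
elim: w => [|x w IHw] /=; first by elim: ps.
by rewrite IHw -all_predI.
Qed.

Definition word n (pi : 'S_n) : seq nat := [seq val (pi i) | i <- enum 'I_n].

Lemma size_word n (pi : 'S_n) : size (word pi) = n.
Proof. by rewrite size_map size_enum_ord. Qed.

Lemma nth_word n (pi : 'S_n) (i : 'I_n) : nth 0 (word pi) i = pi i.
Proof. by rewrite (nth_map i) ?size_enum_ord // nth_ord_enum. Qed.

Lemma val_word n (pi : 'S_n) (i : 'I_n) : val (pi i) = nth 0 (word pi) i.
Proof. by rewrite nth_word. Qed.

Lemma word_inj n : injective (@word n).
Proof.
move=> p q eq_pq; apply/permP=> i; apply: val_inj.
by rewrite !val_word eq_pq.
Qed.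

Lemma perm_word n (pi : 'S_n) : perm_eq (word pi) (iota 0 n).
Proof.
rewrite /word -val_enum_ord (map_comp val pi); apply: perm_map.
apply: uniq_perm; rewrite ?(map_inj_uniq (@perm_inj _ pi)) ?enum_uniq // => i.
rewrite mem_enum; apply/mapP; exists ((pi^-1)%g i); last by rewrite permKV.
by rewrite mem_enum.
Qed.

Lemma word_surj n w : perm_eq w (iota 0 n) -> exists pi : 'S_n, word pi = w.
Proof.
move=> pw; have sw : size w = n by rewrite (perm_size pw) size_iota.
have lt_n (i : 'I_n) : nth 0 w i < n.
  have: nth 0 w i \in w by rewrite mem_nth ?sw.
  by rewrite (perm_mem pw) mem_iota.
have f_inj : injective (fun i => Ordinal (lt_n i)).
  move=> i j [] /eqP; rewrite nth_uniq ?sw //; first by move/eqP/val_inj.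
  by rewrite (perm_uniq pw) iota_uniq.
exists (perm f_inj); apply: (@eq_from_nth _ 0); rewrite size_word ?sw // => i ni.
by rewrite (nth_word _ (Ordinal ni)) permE.
Qed.

Lemma avoids_word n (pi : 'S_n) p :
  avoids pi p = all_suffixes (first_avoids p) (word pi).
Proof.
rewrite /avoids; apply/idP/all_suffixesP; rewrite size_word.
- case: p => a b c /existsPn H i ni.
  + apply/(sortedP 0) => j; rewrite size_drop size_word => nj.
    have nj1 : (i.+1 + j).+1 < n by lia.
    rewrite !nth_drop addnS.
    have /existsPn/(_ (Ordinal (ltnW nj1)))/existsPn/(_ (Ordinal nj1)) :=
      H (Ordinal ni).
    rewrite !val_word /= eqxx /= negb_and; case/orP=> //; lia.
  (* The suffix after [i] is replaced by an arbitrary word with the same size and letters, so that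
     its head [y] can be exposed. *)
  + case: drop (size_drop i.+1 (word pi)) (nth_drop i.+1 0 (word pi)) => // y w.
    rewrite size_word /= => sw Ew.
    have ni1 : i.+1 < n by lia.
    apply/(all_nthP 0) => k kw; have nk : i.+1 + k.+1 < n by lia.
    have -> : y = nth 0 (word pi) i.+1 by rewrite -[i.+1]addn0 -Ew.
    have -> : nth 0 w k = nth 0 (word pi) (i.+1 + k.+1) by rewrite -Ew.
    have /existsPn/(_ (Ordinal ni1))/existsPn/(_ (Ordinal nk)) :=
      H (Ordinal ni).
    rewrite !val_word /= eqxx /= negb_and; case/orP=> //; lia.
- case: p => a b c H; apply/existsPn => i; apply/existsPn => j;
    apply/existsPn => k; rewrite !val_word.
  + apply/and3P=> -[ij /eqP Ek]; apply/negP.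
    (* Position [j] of the whole word is position [j - i.+1] of the suffix after [i]. *)
    have := H i (ltn_ord i) => /= /(sortedP 0) /(_ (j - i.+1)).
    rewrite size_drop size_word !nth_drop addnS subnKC // -Ek; apply.
    have := ltn_ord k; lia.
  + apply/and3P=> -[/eqP Ej jk]; apply/negP.
    have := H i (ltn_ord i); rewrite /= -Ej.
    rewrite (drop_nth 0) ?size_word // => /(all_nthP 0) /(_ (k - j.+1)).
    rewrite size_drop size_word nth_drop subnKC //; apply.
    have := ltn_ord k; lia.
Qed.

Definition valid (ps : seq gpattern) : seq nat -> bool :=
  all_suffixes (fun x w => all (fun p => first_avoids p x w) ps).

(** Reduces each count to listing words, since [word] is a bijection from ['S_n] onto the
    rearrangements of [iota 0 n]. *)
Lemma card_avoiders n ps (L : seq (seq nat)) :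
  uniq L ->
  (forall w, (w \in L) = perm_eq w (iota 0 n) && valid ps w) ->
  #|avoiders n ps| = size L.
Proof.
move=> uL memL; rewrite cardE -(size_map (@word n)); apply: perm_size.
apply: uniq_perm; rewrite ?(map_inj_uniq (@word_inj n)) ?enum_uniq // => w.
rewrite memL; apply/mapP/andP => [[pi] | [/word_surj[pi <-]]].
- rewrite mem_enum inE => av ->; rewrite perm_word /valid all_suffixes_all.
  by split=> //; apply: sub_all av => p; rewrite avoids_word.
- rewrite /valid all_suffixes_all => av; exists pi => //.
  by rewrite mem_enum inE; apply: sub_all av => p; rewrite avoids_word.
Qed.

Lemma perm_uniq_iota n w : perm_eq w (iota 0 n) -> uniq w.
Proof. by move/perm_uniq->; rewrite iota_uniq. Qed.

(** Adjacent letters of [w] are distinct, so intersecting either relation with [!=] changes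
    nothing. *)
Lemma eq_sorted_uniq (r r' : rel nat) w :
  (forall x y, x \in w -> y \in w -> x != y -> r x y = r' x y) -> uniq w ->
  sorted r w = sorted r' w.
Proof.
move=> eqr; rewrite uniq_pairwise => /pairwise_sorted neq_w.
have: sorted [rel x y | (x != y) && r x y] w =
      sorted [rel x y | (x != y) && r' x y] w.
  apply: (@eq_in_sorted _ [in w]) => [x y xw yw /=|]; last exact/allP.
  by case: eqVneq => //= /(eqr _ _ xw yw).
by rewrite !sorted_relI neq_w.
Qed.

(** * Decreasing words *)

Lemma in2_sorted (r : rel nat) w : {in w &, forall x y, r x y} -> sorted r w.
Proof.
move=> rw; apply: (@pairwise_sorted _ r); elim: w rw => //= x w IHw rw.
apply/andP; split; last first.
  by apply: IHw => y z yw zw; apply: rw; rewrite inE ?yw ?zw orbT.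
by apply/allP=> y yw; apply: rw; rewrite inE ?eqxx ?yw ?orbT.
Qed.

Lemma gtn_trans : transitive gtn.
Proof. by move=> y x z /= yx zy; apply: ltn_trans zy yx. Qed.

Lemma sorted_gtn_cons x w :
  sorted gtn (x :: w) = all (gtn x) w && sorted gtn w.
Proof. exact: (path_sortedE gtn_trans). Qed.

Lemma sorted_gtn_cat u v :
  sorted gtn (u ++ v) = [&& allrel gtn u v, sorted gtn u & sorted gtn v].
Proof. by rewrite !(sorted_pairwise gtn_trans) pairwise_cat. Qed.

Lemma decreasing_sorted (r : rel nat) w :
  (forall y z, z < y -> r y z) -> sorted gtn w -> sorted r w.
Proof. by move=> rP; apply: sub_sorted. Qed.

(** For two decreasing runs in a row, only the junction [z m] has to be checked. *)
Lemma one_ascent_sorted (r : rel nat) u z m v :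
  (forall y z, z < y -> r y z) -> sorted gtn (rcons u z) ->
  sorted gtn (m :: v) -> r z m -> sorted r (u ++ z :: m :: v).
Proof.
move=> rP su sv rzm; rewrite sorted_cat_cons (decreasing_sorted rP su) /= rzm.
exact: (decreasing_sorted rP sv).
Qed.

Definition dec_iota (a n : nat) : seq nat := rev (iota a n).

Lemma dec_iota_sorted a n : sorted gtn (dec_iota a n).
Proof. by rewrite rev_sorted iota_ltn_sorted. Qed.

Lemma decreasing_eq w w' :
  sorted gtn w -> sorted gtn w' -> w =i w' -> w = w'.
Proof. by apply: irr_sorted_eq; [apply: gtn_trans | apply: ltnn]. Qed.

Lemma perm_dec_iota a n : perm_eq (dec_iota a n) (iota a n).
Proof. by rewrite perm_rev. Qed.

(** * Part (1) *)

(* For an ascent y < z and x distinct from both, this says y < x < z. *)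
Definition surrounded (x y z : nat) : bool := ~~ (x < y < z) && ~~ (y < z < x).

Definition patterns1 :=
  [:: DashR 1 2 3; DashL 1 2 3; DashR 3 1 2; DashL 3 1 2].

(** 1-23 and 3-12 combine into the condition on adjacent pairs of [w], and 12-3 and 31-2 into the
    condition on its head. *)
Lemma valid1_cons x w :
  valid patterns1 (x :: w) =
  [&& sorted (surrounded x) w,
      if w is y :: w' then all (surrounded x y) w' else true
    & valid patterns1 w].
Proof.
rewrite /valid /= -/(valid patterns1 w) andbT.
rewrite (eq_sorted (e := fun y z => ~~ order_isomorphic _ [:: 1; _; _])
  (e' := fun y z => ~~ (x < y < z))) => [|y z]; last by rewrite order_isomorphicE.
rewrite (eq_sorted (e := fun y z => ~~ order_isomorphic _ [:: 3; _; _])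
  (e' := fun y z => ~~ (y < z < x))) => [|y z]; last by rewrite order_isomorphicE.
rewrite /surrounded (sorted_relI (fun y z => ~~ (x < y < z))).
case: w => [|y w] //=.
rewrite (eq_all (a1 := fun z => ~~ order_isomorphic _ [:: 1; _; _])
  (a2 := fun z => ~~ (x < y < z))) => [|z]; last by rewrite order_isomorphicE.
rewrite (eq_all (a1 := fun z => ~~ order_isomorphic _ [:: 3; _; _])
  (a2 := fun z => ~~ (y < z < x))) => [|z]; last by rewrite order_isomorphicE.
rewrite (all_predI (fun z => ~~ (x < y < z))).
by rewrite -!andbA andbCA; do 2!bool_congr; rewrite andbCA.
Qed.

Lemma decreasing_valid1 w : sorted gtn w -> valid patterns1 w.
Proof.
elim: w => // x w IHw; rewrite sorted_gtn_cons valid1_cons => /andP[/allP xw sw].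
rewrite IHw // andbT decreasing_sorted //=; last by rewrite /surrounded; lia.
case: w xw sw {IHw} => // y w xw; rewrite sorted_gtn_cons => /andP[/allP yw _].
apply/allP=> z /yw; have := xw _ (mem_head _ _).
by rewrite /surrounded /=; lia.
Qed.

(** Induction on [b]. The only ascent goes from the last letter of [b] to [m], and the earlier
    letters of [b] lie between these two. No later letter has a value between two consecutive
    letters of [b], because [(m :: a) ++ b ++ c] is decreasing. *)
Lemma block_swap_valid1 m a b c :
  sorted gtn ((m :: a) ++ b ++ c) -> valid patterns1 (b ++ (m :: a) ++ c).
Proof.
elim: b => [|x b IHb] s_abc; first exact: decreasing_valid1.
have := s_abc; rewrite sorted_gtn_cat allrel_catr.
case/and3P=> /andP[/allrelP ab /allrelP ac] sa.
rewrite cat_cons sorted_gtn_cons all_cat -andbA => /and3P[/allP xb /allP xc s_bc].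
have s_ac : sorted gtn (m :: a ++ c).
  rewrite -cat_cons sorted_gtn_cat sa (cat_sorted2 s_bc) !andbT.
  exact/allrelP.
have mx : x < m by apply: (ab m x); rewrite mem_head.
rewrite cat_cons valid1_cons IHb ?andbT; last first.
  rewrite sorted_gtn_cat sa s_bc !andbT allrel_catr; apply/andP.
  split; apply/allrelP => // s t sa' tb; apply: ab => //.
  by rewrite inE tb orbT.
apply/andP; split.
  have rP y z : z < y -> surrounded x y z by rewrite /surrounded; lia.
  case/lastP: b s_bc xb {IHb ab s_abc} => [|b z] s_bc xb.
    exact: decreasing_sorted s_ac.
  rewrite cat_rcons; apply: one_ascent_sorted => //.
    by case: (cat_sorted2 s_bc).
  have := xb z; rewrite mem_rcons mem_head => /(_ isT) /=.
  by rewrite /surrounded; lia.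
case: b xb s_bc ab {IHb s_abc} => [|y b] xb s_bc ab.
  move: s_ac; rewrite sorted_gtn_cons => /andP[/allP mac _].
  by apply/allP=> t /mac; rewrite /surrounded /=; lia.
have xy := xb y (mem_head _ _).
move: s_bc; rewrite cat_cons sorted_gtn_cons all_cat -andbA.
case/and3P=> /allP yb /allP yc _.
apply/allP=> t; rewrite !mem_cat => /or3P[/yb|ta|/yc]; rewrite /surrounded.
- by move: xy => /=; lia.
- have := ab t x ta (mem_head _ _); move: xy => /=; lia.
- by move: xy => /=; lia.
Qed.

Lemma decreasing_split x w : x \notin w -> sorted gtn w ->
  exists a c, [/\ w = a ++ c, all (ltn x) a & all (gtn x) c].
Proof.
elim: w => [|y w IHw]; first by exists [::], [::].
rewrite inE negb_or sorted_gtn_cons => /andP[xy xw] /andP[/allP yw sw].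
case: (ltnP x y) => lt_xy.
  have [a [c [-> xa xc]]] := IHw xw sw.
  by exists (y :: a), c; rewrite /= lt_xy.
exists [::], (y :: w); split=> //=; apply/andP; split; first by lia.
by apply/allP=> t /yw /=; lia.
Qed.

(** Induction on the word: a new first letter either keeps it decreasing, creates the ascent, or
    extends the block [b] at its front. *)
Lemma valid1_block_swap w : uniq w -> valid patterns1 w ->
  sorted gtn w \/ exists a b c,
    [/\ a != [::], b != [::], w = b ++ a ++ c & sorted gtn (a ++ b ++ c)].
Proof.
elim: w => [|x w IHw]; first by left.
rewrite valid1_cons => uw /and3P[sw hw vw].
have xNw y : y \in w -> x != y.
  by move=> yw; apply: contraTneq uw => ->; rewrite /= yw.
case: (IHw _ vw) => [|dw|]; first by case/andP: uw.
  case: w uw dw xNw {sw hw vw IHw} => [|y w]; first by left.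
  move=> uw dw xNw; case: (ltnP y x) => yx; first by left; rewrite /= yx.
  (* [x] cuts the decreasing word into its larger letters [a] and its smaller letters [c], and forms
     the block [b] alone. *)
  have [a [c [ew xa xc]]] := decreasing_split (proj1 (andP uw)) dw.
  right; exists a, [:: x], c; rewrite ew; split=> //.
    apply: contraTneq xc => a0; move: ew; rewrite a0 /= => <- /=.
    by rewrite ltnNge yx.
  move: dw; rewrite ew sorted_gtn_cat => /and3P[ac sa sc].
  rewrite sorted_gtn_cat sa sorted_gtn_cons xc sc /= !andbT.
  rewrite -cat1s allrel_catr ac andbT.
  by apply/allrelP=> s t /(allP xa) xs; rewrite inE => /eqP->.
case=> a [b [c [a0 b0 ew s_abc]]]; right; exists a, (x :: b), c.
split=> //; first by rewrite ew.
case: b b0 ew s_abc => // s b _ ew.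
rewrite sorted_gtn_cat => /and3P[/allrelP a_bc sa s_bc].
(* Otherwise [x s] and the first letter [m] of [a] would form 12-3. *)
have sx : s < x.
  case: a a0 ew {sa} a_bc => // m a _ ew a_bc.
  have := hw; rewrite ew => /allP /(_ m); rewrite !mem_cat mem_head orbT.
  have := xNw s; rewrite ew mem_head => /(_ isT).
  have := a_bc m s (mem_head _ _) (mem_head _ _).
  by rewrite /surrounded /= => + + /(_ isT); lia.
(* Since [s < t], a letter [t] of [a] below [x] would form 31-2 with [x s]. *)
have xa t : t \in a -> x < t.
  move=> ta; have := xNw t; have := hw; rewrite ew => /allP /(_ t).
  rewrite !mem_cat ta !orbT => /(_ isT) h /(_ isT).
  have := a_bc t s ta (mem_head _ _).
  by move: h; rewrite /surrounded /=; lia.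
rewrite cat_cons -cat1s catA sorted_gtn_cat s_bc andbT.
rewrite sorted_gtn_cat sa /= !andbT allrel_catl.
apply/andP; split; [apply/andP; split|]; apply/allrelP=> p q.
- exact: a_bc.
- rewrite inE => /eqP->; move: s_bc; rewrite cat_cons sorted_gtn_cons.
  by case/andP=> /allP sq _; rewrite inE => /predU1P[->//|/sq /=]; lia.
- by move=> /xa xp; rewrite inE => /eqP->.
Qed.

(** The letters up to index [j] are A B with A of length [i.+1], and the rotation turns them into B
    A. With [i < j] both blocks are nonempty, and the pairs [i < j < n] number ['C(n, 2)]. *)
Definition block_swap (s : seq nat) (j i : nat) : seq nat :=
  rot i.+1 (take j.+1 s) ++ drop j.+1 s.

Lemma block_swapP (s : seq nat) j i : i < j < size s ->
  exists a b c, [/\ block_swap s j i = b ++ a ++ c, s = a ++ b ++ c,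
                    size a = i.+1 & size b = j - i].
Proof.
case/andP=> ij js; exists (take i.+1 (take j.+1 s)), (drop i.+1 (take j.+1 s)).
exists (drop j.+1 s); rewrite /block_swap /rot -catA; split=> //.
- by rewrite catA !cat_take_drop.
- by rewrite !size_takel //; lia.
- by rewrite size_drop size_takel //; lia.
Qed.

Lemma block_swap_cat (a b c : seq nat) : a != [::] -> b != [::] ->
  block_swap (a ++ b ++ c) (size a + size b).-1 (size a).-1 = b ++ a ++ c.
Proof.
rewrite -!size_eq0 -!lt0n => a0 b0; rewrite /block_swap !prednK ?addn_gt0 ?a0 //.
rewrite catA -size_cat take_size_cat // drop_size_cat // rot_size_cat.
by rewrite catA.
Qed.

(** Both block lengths can be read off from the decreasing word and the swapped one, so distinct cut
    points give distinct words. *)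
Lemma index_block_swap (a b c : seq nat) :
  uniq (a ++ b ++ c) -> a != [::] -> b != [::] ->
  index (head 0 (a ++ b ++ c)) (b ++ a ++ c) = size b /\
  index (head 0 (b ++ a ++ c)) (a ++ b ++ c) = size a.
Proof.
case: a => // m a; case: b => // s b u _ _; split.
  rewrite (index_pivot (x := m) (s1 := s :: b)) //.
  move: u; rewrite /= => /andP[+ _]; apply: contra => mb.
  by rewrite mem_cat -cat_cons mem_cat mb orbT.
rewrite (index_pivot (x := s) (s1 := m :: a)) //.
move: u; rewrite cat_uniq => /and3P[_ /hasPn u _].
by apply: u; rewrite mem_head.
Qed.

Lemma card_avoiders1 n : #|avoiders n patterns1| = 1 + 'C(n, 2).
Proof.
pose s := dec_iota 0 n.
have us : uniq s by rewrite rev_uniq iota_uniq.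
have ss : size s = n by rewrite size_rev size_iota.
have swapP j i : j \in iota 0 n -> i \in iota 0 j -> exists a b c,
    [/\ block_swap s j i = b ++ a ++ c, s = a ++ b ++ c,
        size a = i.+1 & size b = j - i] /\ (a != [::]) && (b != [::]).
  rewrite !mem_iota => jn ij.
  have [|a [b [c [e1 e2 e3 e4]]]] := @block_swapP s j i; first by rewrite ss; lia.
  exists a, b, c; split=> //; rewrite -!size_eq0 e3 e4 /=; lia.
pose L := s :: [seq block_swap s j i | j <- iota 0 n, i <- iota 0 j].
rewrite (@card_avoiders _ _ L).
- rewrite /L /= size_allpairs_dep add1n; congr _.+1.
  rewrite (eq_map (size_iota 0)) map_id sumnE -bin2_sum.
  by rewrite /index_iota subn0.
- rewrite /L /=; apply/andP; split.
    (* In a swapped word the first letter of [s] stands at index [size b], which is positive, so the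
       word is not [s]. *)
    apply/allpairsPdep=> -[j [i [jn ij]]].
    have [a [b [c [[-> es _ sb] /andP[a0 b0]]]]] := swapP _ _ jn ij.
    move=> eqs; have := us; rewrite es => u.
    have [+ _] := index_block_swap u a0 b0; rewrite -es -eqs.
    case: (s) es => [|x s']; first by case: (a) a0.
    by move=> _ /=; rewrite eqxx => b1; rewrite -size_eq0 -b1 in b0.
  apply: allpairs_uniq_dep => [|j _|]; rewrite ?iota_uniq //.
  move=> _ _ /allpairsPdep[j [i [jn ij ->]]] /allpairsPdep[j' [i' [jn' ij' ->]]] /=.
  have [a [b [c [[-> es sa sb] /andP[a0 b0]]]]] := swapP _ _ jn ij.
  have [a' [b' [c' [[-> es' sa' sb'] /andP[a0' b0']]]]] := swapP _ _ jn' ij'.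
  move=> eqw; have := us; have := us; rewrite {1}es es' => u u'.
  have [hb ha] := index_block_swap u a0 b0.
  have [hb' ha'] := index_block_swap u' a0' b0'.
  move: ha hb; rewrite eqw -es es' ha' hb' sa sb sa' sb' => -[ei] ej.
  have <- : i' = i by [].
  move: jn ij jn' ij'; rewrite !mem_iota => jn ij jn' ij'.
  by have <- : j' = j by lia.
move=> w; rewrite inE; apply/orP/andP.
  case=> [/eqP->|/allpairsPdep[j [i [jn ij ->]]]].
    by rewrite perm_dec_iota decreasing_valid1 ?dec_iota_sorted.
  have [a [b [c [[-> es _ _] /andP[a0 b0]]]]] := swapP _ _ jn ij.
  split.
    rewrite -(permPr (perm_dec_iota 0 n)) -/s es perm_sym.
    by apply/seq.permP=> p; rewrite !count_cat addnCA.
  case: a a0 es => // m a _ es; apply: block_swap_valid1.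
  by rewrite -es dec_iota_sorted.
case=> pw /(valid1_block_swap (perm_uniq_iota pw))
  [sw|[a [b [c [a0 b0 ew s_abc]]]]]; [left | right].
  apply/eqP/decreasing_eq => //; first exact: dec_iota_sorted.
  by move=> x; rewrite mem_rev (perm_mem pw).
have es : s = a ++ b ++ c.
  apply: decreasing_eq => // [|x]; first exact: dec_iota_sorted.
  by rewrite mem_rev -(perm_mem pw) ew !mem_cat orbCA.
have sz : size a + size b <= n by rewrite -ss es !size_cat addnA leq_addr.
apply/allpairsPdep; exists (size a + size b).-1, (size a).-1.
rewrite !mem_iota ew es block_swap_cat //.
by case: (a) (b) a0 b0 sz => [|x a'] [|y b'] //= _ _ sz; split=> //; lia.
Qed.

(** * Part (2) *)

Definition patterns2 :=
  [:: DashL 1 2 3; DashR 2 1 3; DashL 1 3 2; DashR 1 2 3].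

(** 1-23 and 1-32 together forbid two adjacent letters above [x]; 12-3 and 21-3 together forbid a
    later letter above both [x] and the next letter. Merging them uses that the letters are
    distinct. *)
Lemma valid2_cons x w : uniq (x :: w) ->
  valid patterns2 (x :: w) =
  [&& sorted (fun y z => ~~ ((x < y) && (x < z))) w,
      if w is y :: w' then all (fun z => ~~ ((x < z) && (y < z))) w' else true
    & valid patterns2 w].
Proof.
move=> uxw; have uw : uniq w by case/andP: uxw.
rewrite /valid /= -/(valid patterns2 w) andbT.
rewrite (eq_sorted (e := fun y z => ~~ order_isomorphic _ [:: 1; 2; _])
  (e' := fun y z => ~~ (x < y < z))) => [|y z]; last by rewrite order_isomorphicE.
rewrite (eq_sorted (e := fun y z => ~~ order_isomorphic _ [:: 1; 3; _])
  (e' := fun y z => ~~ (x < z < y))) => [|y z]; last by rewrite order_isomorphicE.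
rewrite -(eq_sorted_uniq (r := fun y z => ~~ (x < y < z) && ~~ (x < z < y))
  (r' := fun y z => ~~ ((x < y) && (x < z)))) // => [|y z _ _]; last by lia.
rewrite (sorted_relI (fun y z => ~~ (x < y < z))).
case: w uxw {uw} => [|y w] uxw //=.
have xy : x != y by move: uxw; rewrite /= inE; case: eqVneq.
rewrite (eq_all (a1 := fun z => ~~ order_isomorphic _ [:: 2; _; _])
  (a2 := fun z => ~~ (y < x < z))) => [|z]; last by rewrite order_isomorphicE.
rewrite (eq_all (a1 := fun z => ~~ order_isomorphic _ [:: 1; _; _])
  (a2 := fun z => ~~ (x < y < z))) => [|z]; last by rewrite order_isomorphicE.
rewrite (eq_all (a1 := fun z => ~~ ((x < z) && (y < z)))
  (a2 := fun z => ~~ (y < x < z) && ~~ (x < y < z))) => [|z]; last by lia.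
rewrite (all_predI (fun z => ~~ (y < x < z))).
by rewrite -!andbA; bool_congr; rewrite andbCA.
Qed.

Definition not_both_in (B : seq nat) (y z : nat) : bool :=
  ~~ ((y \in B) && (z \in B)).

(** The clause on the head lets a letter of [B] be put in front of [w]; it also expresses that a
    word does not begin with [z] once [z] has joined [B]. *)
Definition fits (B w : seq nat) : bool :=
  sorted (not_both_in B) w && (if w is x :: _ then x \notin B else true).

Lemma fits_nil w : fits [::] w.
Proof. by case: w => // x w; rewrite /fits in2_sorted. Qed.

(* All valid words on B ++ S (decreasing, so B holds the largest letters) in which
   no two adjacent letters are in B, and neither is the first one. When the first
   letter is z = max S and B is nonempty, the second letter is the maximum y of
   B; when it is not z, it is smaller than z, so z may join B. *)
Fixpoint fitting_words (B S : seq nat) : seq (seq nat) :=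
  if S is z :: S' then
    (if B is y :: B' then [seq z :: y :: w | w <- fitting_words B' S']
     else [seq z :: w | w <- fitting_words [::] S']) ++ fitting_words (rcons B z) S'
  else if B is [::] then [:: [::]] else [::].

Lemma bin_uphalf m : 'C(m, uphalf m) = 'C(m, m./2).
Proof.
rewrite -[RHS]bin_sub; last by rewrite -{2}[m]odd_double_half; lia.
by congr 'C(_, _); have := odd_double_half m; rewrite uphalf_half; lia.
Qed.

(** The two branches make [B] one letter shorter and one longer, so their lower indices differ by
    one and Pascal's rule adds them. If [B] is empty the first branch leaves it empty, and
    [bin_uphalf] rewrites its index as [m./2], with [m] the size of the tail of [S]. *)
Lemma size_fitting_words B S :
  size (fitting_words B S) = 'C(size S, uphalf (size B + size S)).
Proof.
elim: S B => [|z S IHS] [|y B] //=; rewrite size_cat size_map !IHS.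
  by rewrite add0n add1n bin_uphalf /= binS addnC.
by rewrite /= size_rcons !addnS !addSn /= binS addnC.
Qed.

Lemma sorted_gtn_max y w t : sorted gtn (y :: w) -> t \in y :: w -> t <= y.
Proof.
rewrite sorted_gtn_cons inE => /andP[/allP yw _] /predU1P[->//|/yw /ltnW].
by [].
Qed.

(** Every condition imposed by a first letter concerns letters above it. *)
Lemma valid2_max y w : uniq (y :: w) -> all (gtn y) w ->
  valid patterns2 (y :: w) = valid patterns2 w.
Proof.
move=> u yw; rewrite valid2_cons // in2_sorted /= => [|s t sw _]; last first.
  by have /= := allP yw s sw; lia.
case: w yw {u} => [|t w] //= /andP[_ yw]; rewrite (_ : all _ w) //.
by apply: sub_all yw => s /=; lia.
Qed.

(** If the maximum [y] came after the second letter, it would complete 12-3 or 21-3 with the first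
    two. *)
Lemma second_max x w y B S : sorted gtn (y :: B ++ S) ->
  perm_eq (x :: w) (y :: B ++ S) -> valid patterns2 (x :: w) -> x != y ->
  exists w', w = y :: w'.
Proof.
move=> sBS pw; have uw : uniq (x :: w).
  rewrite (perm_uniq pw); apply: sorted_uniq sBS; [exact: gtn_trans|].
  exact: ltnn.
rewrite valid2_cons // => /and3P[_ hw _] xy.
have: y \in x :: w by rewrite (perm_mem pw) mem_head.
rewrite inE eq_sym (negPf xy) /=; case: w pw uw hw => // y' w pw uw hw.
rewrite inE => /predU1P[<-|yw]; first by exists w.
have le_y t : t \in [:: x, y' & w] -> t <= y.
  by rewrite (perm_mem pw); apply: sorted_gtn_max.
have := le_y x; rewrite mem_head => /(_ isT).
have := le_y y'; rewrite !inE eqxx orbT => /(_ isT).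
have: y' != y by apply: contraTneq uw => ->; rewrite /= yw andbF.
by have := allP hw y yw; lia.
Qed.

Lemma sorted_gtn_mid B z S : sorted gtn (B ++ z :: S) ->
  [/\ {in B, forall t, z < t}, {in S, forall t, t < z},
      {in B & S, forall s t, t < s}, sorted gtn (B ++ S) & uniq (B ++ z :: S)].
Proof.
move=> sBS; have u : uniq (B ++ z :: S).
  by apply: sorted_uniq sBS; [exact: gtn_trans | exact: ltnn].
move: sBS; rewrite sorted_gtn_cat sorted_gtn_cons.
case/and3P=> /allrelP BS sB /andP[/allP zS sS]; split=> //.
- by move=> t tB; apply: BS; rewrite ?mem_head.
- by move=> s t sB' tS; apply: BS; rewrite // inE tS orbT.
rewrite sorted_gtn_cat sB sS !andbT; apply/allrelP=> s t sB' tS.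
by apply: BS; rewrite // inE tS orbT.
Qed.

Definition fitting_word (B S w : seq nat) : bool :=
  [&& perm_eq w (B ++ S), valid patterns2 w & fits B w].

Lemma fitting_word_z_nil z S w : sorted gtn (z :: S) ->
  fitting_word [::] (z :: S) (z :: w) = fitting_word [::] S w.
Proof.
move=> szS; rewrite /fitting_word !fits_nil !andbT /= perm_cons.
case pw: (perm_eq w S) => //=; rewrite valid2_max //.
  rewrite /= (perm_uniq pw) (perm_mem pw).
  by apply: (sorted_uniq gtn_trans ltnn szS).
by rewrite (perm_all _ pw); move: szS; rewrite sorted_gtn_cons => /andP[].
Qed.

(** The adjacency condition for [[:: z]] is void, as [z] occurs only once; what remains is that the
    head is not [z]. *)
Lemma fitting_word_other_nil z S x w : sorted gtn (z :: S) -> x != z ->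
  fitting_word [::] (z :: S) (x :: w) = fitting_word [:: z] S (x :: w).
Proof.
move=> szS xz; rewrite /fitting_word fits_nil /fits inE xz andbT /=.
case pw: (perm_eq (x :: w) (z :: S)) => //=.
have u : uniq (x :: w).
  by rewrite (perm_uniq pw); apply: (sorted_uniq gtn_trans ltnn szS).
rewrite -[path _ x w]/(sorted (not_both_in [:: z]) (x :: w)).
rewrite (eq_sorted_uniq (r' := fun _ _ => true)) // => [|s t _ _ st].
  by rewrite [sorted _ _]in2_sorted ?andbT.
by apply: contraNN st; rewrite !inE => /andP[/eqP-> /eqP->].
Qed.

(** The letters of [w] above [z] are exactly those of [B], so the condition imposed by [z] is the
    one already in [fits]. The maximum [y] imposes none, but its membership in [y :: B] keeps the
    head of [w] out of [B]. *)
Lemma fitting_word_z y B z S w : sorted gtn ((y :: B) ++ z :: S) ->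
  fitting_word (y :: B) (z :: S) (z :: y :: w) = fitting_word B S w.
Proof.
move=> sBS; have [zB Sz BS sBS' u] := sorted_gtn_mid sBS.
rewrite /fitting_word.
have pE : perm_eq (z :: y :: w) ((y :: B) ++ z :: S) = perm_eq w (B ++ S).
  rewrite -[RHS](perm_cons y) -[RHS](perm_cons z); apply: permPr.
  by apply/seq.permP=> p; rewrite /= !count_cat /=; lia.
rewrite pE; case pw: (perm_eq w (B ++ S)) => //=; rewrite pw in pE.
have yBS : all (gtn y) (B ++ S).
  by move: sBS'; rewrite cat_cons sorted_gtn_cons => /andP[].
have uzyw : uniq [:: z, y & w] by rewrite (perm_uniq pE).
have uyw : uniq (y :: w) by case/andP: uzyw.
have yw : all (gtn y) w by rewrite (perm_all _ pw).
have zB' t : t \in w -> (z < t) = (t \in B).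
  rewrite (perm_mem pw) mem_cat; case: (boolP (t \in B)) => [tB _|_ /= /Sz].
    by apply: zB; rewrite inE tB orbT.
  by lia.
have yNw : y \notin w by case/andP: uyw.
have zy : z < y by apply: zB; rewrite mem_head.
have zNyB : z \notin y :: B by apply/negP=> /zB; rewrite ltnn.
rewrite valid2_cons // valid2_max //.
have -> : all (fun t => ~~ ((z < t) && (y < t))) w.
  by apply: sub_all yw => t /=; lia.
have sE : sorted (fun a b => ~~ ((z < a) && (z < b))) w = sorted (not_both_in B) w.
  apply: (@eq_in_sorted _ [in w]) => [a b aw bw|]; last exact/allP.
  by rewrite /not_both_in !zB'.
have sE' : sorted (not_both_in (y :: B)) w = sorted (not_both_in B) w.
  apply: (@eq_in_sorted _ [in w]) => [a b aw bw|]; last exact/allP.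
  have neq_y c : c \in w -> (c == y) = false by move=> cw; apply: contraNF yNw => /eqP<-.
  by rewrite /not_both_in !inE !neq_y.
rewrite /fits zNyB -sE' in sE *.
case: w {pw pE uzyw} uyw yw zB' yNw sE sE' => [|t w] uyw yw zB' yNw sE sE' /=.
  by rewrite /not_both_in (negPf zNyB).
move: sE => /= ->; rewrite zy zB' ?mem_head // /not_both_in (negPf zNyB).
have ty : (t == y) = false by move: yNw; rewrite inE negb_or eq_sym => /andP[/negPf].
rewrite mem_head [t \in y :: B]inE ty /=.
by case: (t \notin B); case: path; case: valid; rewrite ?andbF.
Qed.

(** A head [x] outside [y :: B] and other than [z] is below [z], hence below all of
    [rcons (y :: B) z]. Validity at [x] then already forbids two adjacent letters from that list, so
    [z] may join [B]. *)
Lemma fitting_word_other y B z S x w : sorted gtn ((y :: B) ++ z :: S) -> x != z ->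
  fitting_word (y :: B) (z :: S) (x :: w) = fitting_word (rcons (y :: B) z) S (x :: w).
Proof.
move=> sBS xz; have [zB Sz _ _ u] := sorted_gtn_mid sBS.
rewrite /fitting_word cat_rcons.
case pw: (perm_eq (x :: w) _) => //; case vw: (valid _ _) => //.
have uw : uniq (x :: w) by rewrite (perm_uniq pw).
have rE t : (t \in rcons (y :: B) z) = (t == z) || (t \in y :: B).
  by rewrite mem_rcons inE.
rewrite /fits rE negb_or xz !andTb /sorted.
case xB: (x \notin _); rewrite ?andbF ?andbT //.
have xS : x < z.
  have: x \in (y :: B) ++ z :: S by rewrite -(perm_mem pw) mem_head.
  by rewrite mem_cat (negPf xB) /= inE (negPf xz) => /Sz.
have xy : x != y by apply: contraNneq xB => ->; rewrite mem_head.
have [w' ew] := second_max sBS pw vw xy.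
have sw' : path (not_both_in (rcons (y :: B) z)) x w.
  move: vw; rewrite valid2_cons // => /and3P[sw _ _].
  suff: sorted (not_both_in (rcons (y :: B) z)) w.
    by rewrite ew /= => ->; rewrite /not_both_in -rcons_cons rE (negPf xz) (negPf xB).
  apply: sub_sorted sw => s t; apply: contra => /andP[].
  by rewrite !rE => /predU1P[->|/zB sz] /predU1P[->|/zB tz]; lia.
rewrite sw'; apply: sub_path sw' => s t; apply: contra.
by rewrite !rE => /andP[-> ->]; rewrite !orbT.
Qed.

Lemma mem_fitting_words B S w : sorted gtn (B ++ S) ->
  (w \in fitting_words B S) = fitting_word B S w.
Proof.
elim: S B w => [|z S IHS] B w sBS.
  case: B sBS => [|y B] sBS.
    by rewrite inE /fitting_word; case: w => // x w; case: seq.permP => // /(_ predT).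
  (* With [S] empty all letters lie in [B], so no head is allowed. *)
  rewrite in_nil; apply/esym/negP => /and3P[pw _ /andP[_]].
  case: w pw => [/perm_size//|x w pw].
  by rewrite -[x \in _]/(x \in y :: B) -[y :: B]cats0 -(perm_mem pw) mem_head.
have IHz : (w \in fitting_words (rcons B z) S) = fitting_word (rcons B z) S w.
  by apply: IHS; rewrite cat_rcons.
case: w IHz => [|x w] IHz.
  have NP T : perm_eq [::] (T ++ z :: S) = false.
    by apply/negP=> /perm_size; rewrite size_cat addnS.
  rewrite /fitting_word NP /= mem_cat IHz /fitting_word cat_rcons NP orbF.
  by case: (B) => [|y B']; apply/mapP=> -[].
rewrite /= mem_cat IHz.
have [xz|xz] := eqVneq x z.
  have -> : fitting_word (rcons B z) S (x :: w) = false.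
    by rewrite /fitting_word /fits mem_rcons xz mem_head !andbF.
  rewrite orbF xz; case: B sBS {IHz} => [|y B] sBS.
    have sS : sorted gtn ([::] ++ S).
      by move: sBS; rewrite cat0s sorted_gtn_cons => /andP[].
    by rewrite mem_map => [|s t []//]; rewrite fitting_word_z_nil // IHS.
  have [zB _ _ sBS' _] := sorted_gtn_mid sBS.
  have sBS2 : sorted gtn (B ++ S).
    by move: sBS'; rewrite cat_cons sorted_gtn_cons => /andP[].
  apply/mapP/idP => [[w' w'W [->]]|Hw].
    by rewrite fitting_word_z // -IHS.
  have [w' ew] : exists w', w = y :: w'.
    case/and3P: Hw => pw vw _; apply: second_max sBS pw vw _.
    by rewrite neq_ltn zB ?mem_head.
  by exists w'; rewrite ?ew // IHS // -(fitting_word_z _ sBS) -ew.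
have -> : (x :: w \in if B is y :: B' then [seq z :: y :: w0 | w0 <- fitting_words B' S]
            else [seq z :: w0 | w0 <- fitting_words [::] S]) = false.
  by case: (B) => [|y B']; apply/mapP=> -[w' _ [/eqP]]; rewrite (negPf xz).
case: B sBS {IHz} => [|y B] sBS; first by rewrite fitting_word_other_nil.
by rewrite fitting_word_other.
Qed.

Lemma uniq_fitting_words B S : sorted gtn (B ++ S) -> uniq (fitting_words B S).
Proof.
elim: S B => [|z S IHS] B sBS; first by case: B sBS.
rewrite /= cat_uniq IHS ?cat_rcons // andbT; apply/andP; split.
  have [_ _ _ sBS' _] := sorted_gtn_mid sBS.
  case: B sBS sBS' => [|y B] sBS sBS'; rewrite map_inj_uniq => [|s t []//].
    exact: IHS.
  by apply: IHS; move: sBS'; rewrite cat_cons sorted_gtn_cons => /andP[].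
(* Words of the first branch begin with [z]; those of the second cannot, since [z] is in
   [rcons B z]. *)
apply/hasPn=> w; rewrite mem_fitting_words ?cat_rcons // => /and3P[_ _ /andP[_ hw]].
by case: (B) hw => [|y B'] hw; apply/mapP=> -[w' _ ew];
  move: hw; rewrite ew mem_rcons mem_head.
Qed.

Lemma card_avoiders2 n : #|avoiders n patterns2| = 'C(n, uphalf n).
Proof.
have s0 : sorted gtn ([::] ++ dec_iota 0 n) by apply: dec_iota_sorted.
rewrite (@card_avoiders _ _ (fitting_words [::] (dec_iota 0 n))).
- by rewrite size_fitting_words size_rev size_iota.
- exact: uniq_fitting_words.
move=> w; rewrite mem_fitting_words // /fitting_word fits_nil andbT.
by rewrite (permPr (perm_dec_iota 0 n)).
Qed.

(** * Part (3) *)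

Definition patterns3 :=
  [:: DashL 1 2 3; DashR 2 3 1; DashL 3 1 2; DashR 1 2 3].

Lemma valid3_cons x w :
  valid patterns3 (x :: w) =
  [&& sorted (surrounded x) w,
      if w is y :: w' then
        all (fun z => ~~ (z < x < y) && ~~ (x < y < z)) w'
      else true
    & valid patterns3 w].
Proof.
rewrite /valid /= -/(valid patterns3 w) andbT.
rewrite (eq_sorted (e := fun y z => ~~ order_isomorphic _ [:: 1; _; _])
  (e' := fun y z => ~~ (x < y < z))) => [|y z]; last by rewrite order_isomorphicE.
rewrite (eq_sorted (e := fun y z => ~~ order_isomorphic _ [:: 3; _; _])
  (e' := fun y z => ~~ (y < z < x))) => [|y z]; last by rewrite order_isomorphicE.
rewrite /surrounded (sorted_relI (fun y z => ~~ (x < y < z))).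
case: w => [|y w] //=.
rewrite (eq_all (a1 := fun z => ~~ order_isomorphic _ [:: 2; _; _])
  (a2 := fun z => ~~ (z < x < y))) => [|z]; last by rewrite order_isomorphicE.
rewrite (eq_all (a1 := fun z => ~~ order_isomorphic _ [:: 1; _; _])
  (a2 := fun z => ~~ (x < y < z))) => [|z]; last by rewrite order_isomorphicE.
rewrite (all_predI (fun z => ~~ (z < x < y))).
by rewrite -!andbA; do 2!bool_congr; rewrite andbCA.
Qed.

Lemma decreasing_valid3 w : sorted gtn w -> valid patterns3 w.
Proof.
elim: w => // x w IHw; rewrite sorted_gtn_cons valid3_cons => /andP[/allP xw sw].
rewrite IHw // andbT decreasing_sorted //=; last by rewrite /surrounded; lia.
case: w xw {IHw sw} => // y w xw; apply/allP=> z _.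
by have := xw _ (mem_head _ _); rewrite /=; lia.
Qed.

Definition min_max_ascent (u : seq nat) (z m : nat) (v : seq nat) : bool :=
  [&& z < m, sorted gtn u, sorted gtn v & all (fun x => z < x < m) (u ++ v)].

(** A letter of [u] is followed by a smaller one, so it starts no 23-1 or 12-3; the only ascent
    [z m] surrounds it, so it starts no 1-23 or 3-12. *)
Lemma min_max_ascent_valid3 u z m v :
  min_max_ascent u z m v -> valid patterns3 (u ++ z :: m :: v).
Proof.
case/and4P=> zm; elim: u => [|x u IHu] su sv zm_uv.
  have sw : sorted gtn (m :: v).
    by rewrite sorted_gtn_cons sv andbT; apply: sub_all zm_uv => x /andP[].
  rewrite /= valid3_cons (decreasing_valid3 sw) andbT; apply/andP; split.
    by apply: decreasing_sorted sw => a b; rewrite /surrounded; lia.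
  by apply: sub_all zm_uv => x; lia.
rewrite cat_cons valid3_cons; move: su zm_uv; rewrite sorted_gtn_cons /=.
case/andP=> /allP xu su /andP[zxm zm_uv]; rewrite IHu // andbT.
have /allP zm_uvP := zm_uv.
apply/andP; split.
  apply: one_ascent_sorted; rewrite /surrounded; try lia.
    rewrite (sorted_pairwise gtn_trans) pairwise_rcons.
    rewrite -(sorted_pairwise gtn_trans) su andbT; apply/allP=> y yu.
    by have := zm_uvP y; rewrite mem_cat yu => /(_ isT) /andP[].
  rewrite sorted_gtn_cons sv andbT; apply/allP=> y yv.
  by have := zm_uvP y; rewrite mem_cat yv orbT => /(_ isT) /andP[].
case: u xu {IHu su zm_uv zm_uvP} => [|y u] xu; apply/allP=> a _.
  by lia.
by have := xu _ (mem_head _ _); rewrite /=; lia.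
Qed.

(** Induction on the word: in front of a decreasing word, [x] either extends it or forms the ascent
    with its head, and then 23-1 and 12-3 confine all later letters between the two. Once there is
    an ascent, [x] can only extend [u]. *)
Lemma valid3_min_max_ascent w : uniq w -> valid patterns3 w ->
  sorted gtn w \/ exists u z m v, w = u ++ z :: m :: v /\ min_max_ascent u z m v.
Proof.
elim: w => [|x w IHw]; first by left.
rewrite valid3_cons => uw /and3P[sw hw vw].
case: (IHw _ vw) => [|dw|]; first by case/andP: uw.
  case: w uw sw hw {vw IHw} dw => [|y w]; first by left.
  move=> uw _ hw dw; case: (ltnP y x) => yx; first by left; rewrite /= yx.
  have xy : x != y by move: uw; rewrite /= inE; case: eqVneq.
  right; exists [::], x, y, w; split=> //; rewrite /min_max_ascent /=.
  move: dw; rewrite sorted_gtn_cons => /andP[/allP yw ->]; apply/and3P; split=> //.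
    by lia.
  apply/allP=> z zw; have := yw z zw; have := allP hw z zw.
  have: x != z by apply: contraTneq uw => ->; rewrite /= inE zw orbT.
  by rewrite /=; lia.
case=> u [z [m [v [ew /and4P[zm su sv zm_uv]]]]]; right.
exists (x :: u), z, m, v; rewrite ew; split=> //.
have xNw y : y \in w -> x != y.
  by move=> yw; apply: contraTneq uw => ->; rewrite /= yw.
have zxm : z < x < m.
  have := xNw z; have := xNw m; rewrite ew !mem_cat !inE !eqxx !orbT.
  move=> /(_ isT) xm /(_ isT) xz.
  by move: sw; rewrite ew sorted_cat_cons /= => /and3P[_ + _]; rewrite /surrounded; lia.
rewrite /min_max_ascent zm sv sorted_gtn_cons su /= zxm zm_uv !andbT.
case: u ew su {zm_uv} => //= s u ew; rewrite (path_sortedE gtn_trans).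
case/andP=> /allP sv' _.
(* Otherwise [x s] would form 23-1 with the later letter [z]. *)
have xs : s < x.
  have := xNw s; rewrite ew mem_head => /(_ isT).
  have zw : z \in u ++ z :: m :: v by rewrite mem_cat mem_head orbT.
  by move: hw; rewrite ew => /allP/(_ _ zw); lia.
by rewrite xs; apply/allP=> t /sv' /=; lia.
Qed.

(** Recovers a mask from the letters it selects, whence the injectivity of [min_max_word k]. *)
Lemma map_mem_mask (T : eqType) (b : bitseq) (s : seq T) :
  uniq s -> size b = size s -> [seq x \in mask b s | x <- s] = b.
Proof.
elim: s b => [|x s IHs] [|c b] //= /andP[xs us] [sb].
have xb : x \notin mask b s by apply: contra xs => /mem_mask.
congr (_ :: _); first by case: c; rewrite ?mem_head // (negPf xb).
rewrite -[RHS](IHs b) //; apply/eq_in_map => y ys; case: c => //.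
by rewrite inE; case: eqVneq ys xs => // ->  ->.
Qed.

Lemma perm_mask_compl (T : eqType) (b : bitseq) (s : seq T) :
  size b = size s -> perm_eq (mask b s ++ mask (map negb b) s) s.
Proof.
elim: s b => [|x s IHs] [|[] b] //= [sb]; first by rewrite perm_cons IHs.
by rewrite -cat1s perm_catCA /= perm_cons IHs.
Qed.

Definition min_max_word (k : nat) (b : bitseq) : seq nat :=
  mask b (dec_iota 1 k) ++
  0 :: k.+1 :: mask (map negb b) (dec_iota 1 k).

Lemma notin0_mask b k : 0 \notin mask b (dec_iota 1 k).
Proof.
by apply/negP=> /mem_mask; rewrite mem_rev mem_iota.
Qed.

Lemma min_max_word_min_max_ascent k b : size b = k ->
  min_max_ascent (mask b (dec_iota 1 k)) 0 k.+1 (mask (map negb b) (dec_iota 1 k)).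
Proof.
move=> sb; rewrite /min_max_ascent !(sorted_mask gtn_trans) ?dec_iota_sorted //=.
apply/allP=> y; rewrite (perm_mem (perm_mask_compl _)); last first.
  by rewrite size_rev size_iota.
by rewrite mem_rev mem_iota; lia.
Qed.

Lemma iota_ends k : perm_eq (iota 0 k.+2) (0 :: k.+1 :: iota 1 k).
Proof.
rewrite -[iota 0 _]/(0 :: iota 1 k.+1) perm_cons.
by have := iotaD 1 k 1; rewrite addn1 add1n => ->; rewrite perm_catC.
Qed.

Lemma perm_min_max_word k b : size b = k -> perm_eq (min_max_word k b) (iota 0 k.+2).
Proof.
move=> sb; rewrite perm_sym (perm_trans (iota_ends k)) // perm_sym.
rewrite /min_max_word -[0 :: _ :: _]/([:: 0; k.+1] ++ _) perm_catCA /= !perm_cons.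
apply: perm_trans (perm_mask_compl _) _; first by rewrite size_rev size_iota.
exact: perm_dec_iota.
Qed.

Lemma min_max_ascent_min_max_word k u z m v :
  min_max_ascent u z m v -> perm_eq (u ++ z :: m :: v) (iota 0 k.+2) ->
  exists2 b, size b = k & u ++ z :: m :: v = min_max_word k b.
Proof.
case/and4P=> zm su sv /allP zm_uv pw; set w := u ++ _ in pw *.
have zw : z \in w by rewrite mem_cat mem_head orbT.
have mw : m \in w by rewrite mem_cat !inE eqxx !orbT.
have between x : x \in w -> z <= x <= m.
  rewrite mem_cat !inE => /or4P[xu|/eqP->|/eqP->|xv]; try lia.
    by have := zm_uv x; rewrite mem_cat xu => /(_ isT); lia.
  by have := zm_uv x; rewrite mem_cat xv orbT => /(_ isT); lia.
have z0 : z = 0.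
  by have := between 0; rewrite (perm_mem pw) mem_iota => /(_ isT); lia.
have mk : m = k.+1.
  have := between k.+1; rewrite (perm_mem pw) mem_iota ltnSn => /(_ isT).
  by move: mw; rewrite (perm_mem pw) mem_iota; lia.
have uvk : perm_eq (u ++ v) (dec_iota 1 k).
  rewrite perm_sym (perm_trans (perm_dec_iota _ _)) // perm_sym.
  rewrite -(perm_cons m) -(perm_cons z) z0 mk.
  apply: perm_trans _ (iota_ends k); rewrite perm_sym -(permPl pw) perm_sym.
  by rewrite /w z0 mk; apply/seq.permP=> p; rewrite /= !count_cat /=; lia.
have uuv : uniq (u ++ v) by rewrite (perm_uniq uvk) rev_uniq iota_uniq.
have disj x : x \in u ++ v -> (x \in v) = (x \notin u).
  rewrite mem_cat; move: uuv; rewrite cat_uniq => /and3P[_ /hasPn uv _].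
  by case: (boolP (x \in v)) => [/uv /= ->|_]; rewrite ?orbF // => ->.
(* The mask marks the letters of [u]; [u] and [v], being decreasing, are determined by their sets of
   letters. *)
exists [seq x \in u | x <- dec_iota 1 k]; first by rewrite size_map size_rev size_iota.
rewrite /w /min_max_word z0 mk -map_comp -!filter_mask; congr (_ ++ _ :: _ :: _).
  apply: decreasing_eq => //.
    by rewrite (sorted_filter gtn_trans) ?dec_iota_sorted.
  by move=> x; rewrite mem_filter -(perm_mem uvk) mem_cat; case: (x \in u).
apply: decreasing_eq => //.
  by rewrite (sorted_filter gtn_trans) ?dec_iota_sorted.
move=> x; rewrite mem_filter -(perm_mem uvk) /=.
case: (boolP (x \in u ++ v)) => [/disj->|]; first by rewrite andbT.
by rewrite mem_cat negb_or andbF => /andP[_ /negPf].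
Qed.

Lemma card_avoiders3 n : 2 <= n -> #|avoiders n patterns3| = 2 ^ (n - 2) + 1.
Proof.
case: n => [|[|k]] // _; rewrite subn2 /=.
rewrite (@card_avoiders _ _
  (dec_iota 0 k.+2 :: [seq min_max_word k (val b) | b <- enum {: k.-tuple bool}])).
- by rewrite /= size_map -cardE card_tuple card_bool addn1.
- rewrite /= map_inj_uniq ?enum_uniq ?andbT => [|b b' eqb].
    apply/mapP => -[b _ eqb].
    have := dec_iota_sorted 0 k.+2; rewrite eqb /min_max_word sorted_cat_cons.
    by rewrite /= andbF.
  apply: val_inj; have sz (c : k.-tuple bool) : size c = size (dec_iota 1 k).
    by rewrite size_rev size_iota size_tuple.
  have uk : uniq (dec_iota 1 k) by rewrite rev_uniq iota_uniq.
  rewrite -[LHS](map_mem_mask uk (sz b)) -[RHS](map_mem_mask uk (sz b')).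
  (* The letters before [0] are exactly the selected ones. *)
  have := congr1 (fun w => take (index 0 w) w) eqb.
  by rewrite !take_pivot ?notin0_mask // => ->.
move=> w; rewrite inE; apply/orP/andP.
  case=> [/eqP->|/mapP[b _ ->]].
    by rewrite perm_dec_iota decreasing_valid3 ?dec_iota_sorted.
  by rewrite perm_min_max_word ?size_tuple // min_max_ascent_valid3 //;
    rewrite min_max_word_min_max_ascent ?size_tuple.
case=> pw /(valid3_min_max_ascent (perm_uniq_iota pw))
  [sw|[u [z [m [v [ew sw]]]]]]; [left | right].
  apply/eqP/decreasing_eq => //; first exact: dec_iota_sorted.
  by move=> x; rewrite mem_rev (perm_mem pw).
rewrite {}ew in pw *.
have [b /eqP sb ->] := min_max_ascent_min_max_word sw pw.
by apply/mapP; exists (Tuple sb); rewrite ?mem_enum.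
Qed.

(** * Part (4) *)

Definition patterns4 :=
  [:: DashR 1 2 3; DashL 2 1 3; DashR 3 2 1; DashR 2 1 3].

Lemma valid4_cons x w :
  valid patterns4 (x :: w) =
  [&& sorted (fun y z => ~~ (y < x < z)) w,
      if w is y :: w' then
        all (fun z => [&& ~~ (x < y < z), ~~ (z < y < x) & ~~ (y < x < z)]) w'
      else true
    & valid patterns4 w].
Proof.
rewrite /valid /= -/(valid patterns4 w) andbT.
rewrite (eq_sorted (e' := fun y z => ~~ (y < x < z))) => [|y z]; last first.
  by rewrite order_isomorphicE.
case: w => [|y w] //=.
rewrite (eq_all (a2 := fun z => ~~ (x < y < z))) => [|z]; last first.
  by rewrite order_isomorphicE.
rewrite [all (fun z => ~~ order_isomorphic _ [:: 3; _; _]) w]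
  (eq_all (a2 := fun z => ~~ (z < y < x))) => [|z]; last first.
  by rewrite order_isomorphicE.
rewrite [all (fun z => ~~ order_isomorphic _ [:: 2; _; _]) w]
  (eq_all (a2 := fun z => ~~ (y < x < z))) => [|z]; last first.
  by rewrite order_isomorphicE.
by rewrite !(all_predI _ _ w); case: path; rewrite ?andbF //= -!andbA.
Qed.

Definition beyond (b : bool) (x y : nat) : bool := if b then x < y else y < x.

Fixpoint zigzag (b : bool) (w : seq nat) : bool :=
  if w is x :: w' then all (beyond b x) w' && zigzag (~~ b) w' else true.

Lemma zigzag_cons b x w :
  zigzag b (x :: w) = all (beyond b x) w && zigzag (~~ b) w.
Proof. by []. Qed.

Definition topped_zigzag (w : seq nat) : bool :=
  if w is x :: y :: w' then
    [&& x < y, all (beyond false x) w' & zigzag true w']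
  else false.

Definition some_zigzag (w : seq nat) : bool :=
  [|| zigzag true w, zigzag false w | topped_zigzag w].

(** The head is an extremum of its suffix, so it is never the middle value in 2-13 or 21-3. The next
    letter is the opposite extremum, which excludes 12-3 and 32-1. *)
Lemma zigzag_valid4 b w : zigzag b w -> valid patterns4 w.
Proof.
elim: w b => // x w IHw b; rewrite valid4_cons /= => /andP[/allP xw zw].
rewrite (IHw _ zw) andbT; apply/andP; split.
  apply: in2_sorted => y z /xw + /xw.
  by case: (b) => /= ? ?; lia.
case: w zw xw {IHw} => //= y w /andP[/allP yw _] xw.
apply/allP=> z zw; have := yw z zw; have := xw y (mem_head _ _).
have: z \in y :: w by rewrite inE zw orbT.
by move/xw; case: (b) => /=; lia.
Qed.

(** From [y] on the word is a zigzag. The only letter above [x] is [y], which comes immediately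
    after it, so no pattern starts at [x]. *)
Lemma topped_zigzag_valid4 w : topped_zigzag w -> valid patterns4 w.
Proof.
case: w => // x [|y w] //= /and3P[xy /allP xw zw].
rewrite valid4_cons (@zigzag_valid4 false) ?andbT /=; last first.
  by rewrite zw andbT; apply/allP=> z /xw /=; lia.
apply/andP; split; last by apply/allP=> z /xw /=; lia.
case: w xw {zw} => //= z w xw; apply/andP; split; first by lia.
by apply: (@in2_sorted _ (z :: w)) => s t /xw /= ? /xw /= ?; lia.
Qed.

Lemma all_beyond_nil b y w :
  all (beyond b y) w -> all (beyond (~~ b) y) w -> w = [::].
Proof.
by case: w => // z w /= /andP[+ _] /andP[+ _]; case: b => /=; lia.
Qed.

(** If [x < y], then 12-3 makes [y] the maximum; if [y < x], then 32-1 and 21-3 make [x] the maximum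
    and [y] the minimum. Each shape of [y :: w] is then extended or collapses to a short word. *)
Lemma valid4_zigzag w : uniq w -> valid patterns4 w -> some_zigzag w.
Proof.
elim: w => // x w IHw uw; rewrite valid4_cons => /and3P[sw hw vw].
have {vw} := IHw (proj2 (andP uw)) vw; rewrite /some_zigzag.
case: w uw sw hw {IHw} => // y w uw sw /allP hw.
have xy : x != y by move: uw; rewrite /= inE; case: eqVneq.
have nxy z : z \in w -> (z != x) && (z != y).
  move=> zw; move: uw => /= /and3P[]; rewrite inE negb_or => /andP[_ xw] yw _.
  by rewrite (memPn xw) ?(memPn yw).
case: (ltngtP x y) xy => // xy _.
  have wy : all (beyond false y) w.
    by apply/allP=> z zw; have := hw z zw; have := nxy z zw; rewrite /= xy; lia.
  case/or3P => [/andP[wy' _]|/andP[_ zw]|].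
  - by rewrite (all_beyond_nil wy wy') /= xy.
  - have {}zw : zigzag true w := zw.
    suff: all (beyond true x) w || all (beyond false x) w.
      by case/orP=> xw; rewrite /= xy wy zw xw ?orbT.
    case: w zw sw nxy {uw hw wy} => // a w; rewrite zigzag_cons => /andP[/allP aw zw] sw nxy.
    have xa : x != a by have := nxy a (mem_head _ _); lia.
    case: w aw zw sw nxy => [|b w] aw zw sw nxy; first by rewrite /=; lia.
    have xb : x != b by have := nxy b; rewrite !inE eqxx orbT => /(_ isT); lia.
    have ab := aw b (mem_head _ _); have := zw; rewrite zigzag_cons => /andP[/allP bw _].
    case: (ltnP x a) => [lt_xa|le_ax]; apply/orP; [left|right].
      by apply/allP=> z; rewrite inE => /predU1P[->|/aw] /=; lia.
    (* Here [a] and [b] are the minimum and the maximum of [w], and [a < x < b] would make [x a b]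
       an occurrence of 2-13. *)
    have bx : b < x by move: sw ab xb xa le_ax => /= /and3P[_ + _]; lia.
    have ax : a < x by lia.
    by rewrite /= bx ax /=; apply/allP=> z /bw /=; lia.
  - by case: w wy {uw sw hw nxy} => // a w /andP[/= ya _] /and3P[]; lia.
have wx : all (beyond false x) w.
  by apply/allP=> z zw; have := hw z zw; have := nxy z zw; rewrite /=; lia.
have wy : all (beyond true y) w.
  by apply/allP=> z zw; have := hw z zw; have := nxy z zw; rewrite /=; lia.
case/or3P => [/andP[_ zw]|/andP[wy' _]|].
- by have {}zw : zigzag false w := zw; rewrite /= xy wx wy zw !orbT.
- by rewrite (all_beyond_nil wy wy') /= xy orbT.
- case: w wx wy {uw sw hw nxy} => // a w wx /andP[/= ya wy] /and3P[_ wy' _].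
  rewrite (@all_beyond_nil true y w wy wy') /= xy ya /= !andbT.
  by move: wx => /= /andP[->]; rewrite !orbT.
Qed.

(** Both heads are the same extremum of the same set of letters. *)
Lemma perm_beyond_head b x w x' w' :
  all (beyond b x) w -> all (beyond b x') w' ->
  perm_eq (x :: w) (x' :: w') -> x = x' /\ perm_eq w w'.
Proof.
move=> /allP xw /allP xw' pw.
have eq_x : x = x'.
  have: x \in x' :: w' by rewrite -(perm_mem pw) mem_head.
  have: x' \in x :: w by rewrite (perm_mem pw) mem_head.
  rewrite !inE => /predU1P[//|/xw h1] /predU1P[//|/xw'].
  by case: b h1 {xw xw'} => /=; lia.
by split=> //; move: pw; rewrite eq_x perm_cons.
Qed.

Lemma zigzag_perm_eq b w w' :
  zigzag b w -> zigzag b w' -> perm_eq w w' -> w = w'.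
Proof.
elim: w b w' => [|x w IHw] b [|x' w'] //=; [by move=> _ _ /perm_size|
  by move=> _ _ /perm_size|].
move=> /andP[xw zw] /andP[xw' zw'] /(perm_beyond_head xw xw')[-> pw].
by rewrite (IHw _ _ zw zw' pw).
Qed.

Lemma topped_zigzag_perm_eq w w' :
  topped_zigzag w -> topped_zigzag w' -> perm_eq w w' -> w = w'.
Proof.
case: w => [|x [|y w]] //; case: w' => [|x' [|y' w']] //=.
move=> /and3P[xy xw zw] /and3P[xy' xw' zw'] pw.
(* With the first two letters exchanged, the word begins with its two largest letters in decreasing
   order, and heads can be compared one by one. *)
have yw : all (beyond false y) (x :: w).
  by rewrite /= xy; apply: sub_all xw => z /=; lia.
have yw' : all (beyond false y') (x' :: w').
  by rewrite /= xy'; apply: sub_all xw' => z /=; lia.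
have [] := perm_beyond_head yw yw'.
  by apply/seq.permP=> p; move/seq.permP/(_ p): pw => /=; lia.
move=> -> /(perm_beyond_head xw xw')[-> /(zigzag_perm_eq zw zw') ->].
by [].
Qed.

Fixpoint zigzag_from (b : bool) (a n : nat) : seq nat :=
  if n is n'.+1 then
    if b then a :: zigzag_from false a.+1 n' else a + n' :: zigzag_from true a n'
  else [::].

Lemma perm_zigzag_from b a n : perm_eq (zigzag_from b a n) (iota a n).
Proof.
elim: n b a => // n IHn [] a; first by rewrite /= perm_cons.
by rewrite -addn1 iotaD addn1 /= perm_sym perm_catC /= perm_cons perm_sym.
Qed.

Lemma zigzag_zigzag_from b a n : zigzag b (zigzag_from b a n).
Proof.
elim: n b a => // n IHn [] a /=; rewrite IHn andbT; apply/allP=> y;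
  by rewrite (perm_mem (perm_zigzag_from _ _ _)) mem_iota /=; lia.
Qed.

Lemma card_avoiders4 n : 3 <= n -> #|avoiders n patterns4| = 3.
Proof.
case: n => [|[|[|n]]] // _.
pose t := n.+1 :: n.+2 :: zigzag_from true 0 n.+1.
pose z b := zigzag_from b 0 n.+3.
have pz b : perm_eq (z b) (iota 0 n.+3) by apply: perm_zigzag_from.
have zz b : zigzag b (z b) by apply: zigzag_zigzag_from.
have pt : perm_eq t (iota 0 n.+3).
  have := iotaD 0 n.+1 2; rewrite addn2 => ->.
  by rewrite perm_sym perm_catC /= !perm_cons perm_sym perm_zigzag_from.
have tt : topped_zigzag t.
  apply/and3P; split; [exact: ltnSn | | exact: (zigzag_zigzag_from true)].
  apply/allP=> y; rewrite (perm_mem (perm_zigzag_from true _ _)) mem_iota /=.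
  by lia.
rewrite (@card_avoiders _ _ [:: z true; z false; t]) //.
  (* The three words begin with [0], [n.+2] and [n.+1], which are distinct. *)
  rewrite /= !inE /z /t /= !eqseq_cons.
  by have -> : (0 + n.+2 == n.+1) = false by lia.
move=> w; rewrite !inE; apply/or3P/andP.
  case=> /eqP ->; split=> //; try exact: zigzag_valid4.
  exact: topped_zigzag_valid4.
case=> pw /(valid4_zigzag (perm_uniq_iota pw)) /or3P[] sw;
  [constructor 1 | constructor 2 | constructor 3]; apply/eqP.
- apply: zigzag_perm_eq sw (zz _) _; apply: perm_trans pw _; by rewrite perm_sym.
- apply: zigzag_perm_eq sw (zz _) _; apply: perm_trans pw _; by rewrite perm_sym.
- by apply: topped_zigzag_perm_eq => //; apply: perm_trans pw _; rewrite perm_sym.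
Qed.

Theorem mainTheorem4 :
  (forall n : nat, 1 <= n ->
     #|avoiders n [:: DashR 1 2 3; DashL 1 2 3; DashR 3 1 2; DashL 3 1 2]|
       = 1 + 'C(n, 2)) /\
  (forall n : nat, 1 <= n ->
     #|avoiders n [:: DashL 1 2 3; DashR 2 1 3; DashL 1 3 2; DashR 1 2 3]|
       = 'C(n, uphalf n)) /\
  (forall n : nat, 2 <= n ->
     #|avoiders n [:: DashL 1 2 3; DashR 2 3 1; DashL 3 1 2; DashR 1 2 3]|
       = 2 ^ (n - 2) + 1) /\
  (forall n : nat, 3 <= n ->
     #|avoiders n [:: DashR 1 2 3; DashL 2 1 3; DashR 3 2 1; DashR 2 1 3]|
       = 3).
Proof.
split=> [n _|]; first exact: card_avoiders1.
split=> [n _|]; first exact: card_avoiders2.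
split; [exact: card_avoiders3 | exact: card_avoiders4].
Qed.
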